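(* Let $p(x,y):=xy(y-x^\ell)$, where $\ell\in\mathbb{N}\setminus\{1\}$. Then, for every $n\ge\ell+2$, there exists a truncated sequence $\beta^{(2n)}$ having the $k$-extension property relative to $\{1,p,-p\}$ for every $k\in\mathbb{N}_0$, but admitting no $\mathcal{Z}_p$-representing measure.
   Context: Here $\mathbb{N}=\{1,2,\ldots\}$, $\mathbb{N}_0=\mathbb{N}\cup\{0\}$, $\mathcal{P}_m=\{f\in\mathbb{R}[x,y]:\deg f\le m\}$, and $\mathcal{Z}_p=\{(x,y)\in\mathbb{R}^2:p(x,y)=0\}$. A truncated (bivariate) sequence of degree $2n$ is a family of real numbers $\beta\equiv\beta^{(2n)}=\{\beta_{i,j}\}_{i,j\in\mathbb{N}_0,\,i+j\le 2n}$. Its Riesz functional is the linear map $L_\beta:\mathcal{P}_{2n}\to\mathbb{R}$ with $L_\beta(x^iy^j)=\beta_{i,j}$. Let $\mathcal{B}_m$ denote the set of monomials of degree at most $m$. The moment matrix $M(n)\equiv M(n;\beta)$ is the symmetric matrix indexed by $\mathcal{B}_n\times\mathcal{B}_n$ whose entry at monomials $(u,v)$ is $L_\beta(uv)$. For a polynomial $f$ of degree $\delta\le 2n$, the localizing matrix $M_f(n)\equiv M_f(n;\beta)$ is the symmetric matrix indexed by $\mathcal{B}_{n-\lceil\delta/2\rceil}\times\mathcal{B}_{n-\lceil\delta/2\rceil}$ whose entry at $(u,v)$ is $L_\beta(fuv)$. For $k\in\mathbb{N}_0$, a positive extension of $M(n)$ of order $n+k$ is a moment matrix $M(n+k)\succeq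 0$ (of some truncated sequence of degree $2(n+k)$) whose principal submatrix indexed by $\mathcal{B}_n$ equals $M(n)$. The sequence $\beta^{(2n)}$ has the $k$-extension property relative to $\{1,p,-p\}$ if $M(n)$ admits a positive extension $M(n+k)$ such that $M_{p}(n+k)\succeq 0$ and $M_{-p}(n+k)\succeq 0$. A $\mathcal{Z}_p$-representing measure for $\beta^{(2n)}$ is a positive Borel measure $\mu$ on $\mathbb{R}^2$ supported on $\mathcal{Z}_p$ with $\beta_{i,j}=\int x^iy^j\,d\mu$ for all $i+j\le 2n$. *)

(* Defs.v *)
From mathcomp Require Import all_boot all_order all_algebra.
(* The notation levels of mpoly are only compatible with those of
   mathcomp-analysis when mpoly is imported first. *)
From mathcomp Require Import mpoly.
From mathcomp Require Import classical_sets reals ereal measure.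
From mathcomp Require Import lebesgue_measure lebesgue_integral.

Set Implicit Arguments.
Unset Strict Implicit.
Unset Printing Implicit Defensive.

Import Order.TTheory GRing.Theory Num.Theory.

Local Open Scope classical_set_scope.
Local Open Scope ring_scope.

(* x ^ i * y ^ j is the multinomial m with m ord0 = i and m ord_max = j. *)
Definition monoms (d : nat) := 'X_{1..2 < d.+1}.

Definition tseq (R : Type) (d : nat) := monoms d -> R.

Section MomentProblem.
Variable R : realType.

Definition varx : {mpoly R[2]} := 'X_ord0.
Definition vary : {mpoly R[2]} := 'X_ord_max.

Definition mpdeg (f : {mpoly R[2]}) : nat := (msize f).-1.

(* Defined on all polynomials by ignoring the coefficients in degree > d; it is
   only applied to polynomials of degree at most d. *)
Definition riesz (d : nat) (beta : tseq R d) (f : {mpoly R[2]}) : R :=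
  \sum_(m : monoms d) f@_m * beta m.

Definition basis_monom (n : nat) (i : 'I_#|{: monoms n}|) : {mpoly R[2]} :=
  'X_[bmnm (enum_val i : monoms n)].

Definition moment_mx (n : nat) (beta : tseq R n.*2) : 'M[R]_#|{: monoms n}| :=
  \matrix_(i, j) riesz beta (basis_monom i * basis_monom j).

(* Meaningful for mpdeg f <= 2 n. *)
Definition localizing_mx (n : nat) (beta : tseq R n.*2) (f : {mpoly R[2]}) :
    'M[R]_#|{: monoms (n - uphalf (mpdeg f))}| :=
  \matrix_(i, j) riesz beta (f * basis_monom i * basis_monom j).

Definition psd (N : nat) (M : 'M[R]_N) : Prop :=
  M^T = M /\ forall v : 'cV[R]_N, 0 <= (v^T *m M *m v) ord0 ord0.

Lemma widen_monom_subproof (n k : nat) (u : monoms n) :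
  (mdeg u < (n + k).+1)%N.
Proof. by apply: leq_trans (bmdeg u) _; rewrite ltnS leq_addr. Qed.

Definition widen_monom (n k : nat) (u : monoms n) : monoms (n + k) :=
  BMultinom (widen_monom_subproof k u).

Definition principal_submx (n k : nat) (M : 'M[R]_#|{: monoms (n + k)}|) :
    'M[R]_#|{: monoms n}| :=
  let emb i := enum_rank (widen_monom k (enum_val i)) in mxsub emb emb M.

Definition positive_extension (n k : nat) (beta : tseq R n.*2)
    (gamma : tseq R (n + k).*2) : Prop :=
  psd (moment_mx gamma) /\ principal_submx (moment_mx gamma) = moment_mx beta.

(* The k-extension property relative to {1, p, -p}. *)
Definition extension_property (n : nat) (beta : tseq R n.*2)
    (p : {mpoly R[2]}) (k : nat) : Prop :=
  exists gamma : tseq R (n + k).*2,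
    [/\ positive_extension beta gamma,
        psd (localizing_mx gamma p) & psd (localizing_mx gamma (- p))].

Definition zero_set (p : {mpoly R[2]}) : set (R * R) :=
  [set z | p.@[tnth [tuple z.1; z.2]] = 0].

(* The product sigma-algebra on R * R is the Borel sigma-algebra of the plane;
   as zero_set p is closed, mu is supported on it iff its complement is null. *)
Definition representing_measure (d : nat) (beta : tseq R d)
    (p : {mpoly R[2]})
    (mu : {measure set (measurableTypeR R * measurableTypeR R) -> \bar R}) :
    Prop :=
  mu (~` zero_set p) = 0%E /\
  forall m : monoms d,
    let f := fun z : measurableTypeR R * measurableTypeR R =>
      ((z.1 : R) ^+ m ord0 * (z.2 : R) ^+ m ord_max)%:E in
    mu.-integrable setT f /\ (\int[mu]_z f z = (beta m)%:E)%E.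

Definition curve_poly (l : nat) : {mpoly R[2]} :=
  varx * vary * (vary - varx ^+ l).

End MomentProblem.

Arguments curve_poly R l : clear implicits.

(* Main.v *)
Require Import Defs.
From HB Require Import structures.
From mathcomp Require Import all_boot all_order all_algebra mpoly.
From mathcomp Require Import ring lra zify.
From mathcomp Require Import classical_sets reals ereal measure lebesgue_measure.
From mathcomp Require Import lebesgue_integral measurable_realfun.

(** The sequence is obtained by truncating one linear functional [witness] on
    the whole polynomial ring, which vanishes on the ideal of
    [p = x y (y - x ^ l)] and is nonnegative on squares.  Its truncation at
    degree [2 (n + k)] then is a positive extension for every [k], with both
    localizing matrices equal to zero.

    What rules out a measure is the polynomial [y (y - x ^ l)].  On the zero
    set of [p] it is nonnegative: it vanishes on the x-axis and on the graph
    [y = x ^ l], and equals [y ^ 2] on the y-axis.  The witness takes the value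
    [-1] on it.  Such a functional can exist because [y (y - x ^ l)] is not a
    sum of squares modulo [p].  Indeed, write [a], [b], [c] for the restrictions
    of a polynomial [g] to the x-axis, the y-axis and the graph.  The three
    branches meet at the origin, which forces [b_0 = a_0], and the x-axis and
    the graph have contact of order [l] there, which forces [b_1 = c_l - a_l]
    (lemmas [pullbacks_at_origin] and [pullbacks_tangency]).  If a
    sum of squares vanishes on the x-axis and on the graph, then so does each
    summand [g], hence [b_0 = b_1 = 0], and the sum has no [y ^ 2] term on the
    y-axis.

    To turn this into a functional, let [S] be the functional on univariate
    polynomials with moments [2 * 5 ^ (m ^ 2)].  These are moments of a
    log-normal law, up to the factor 2; they grow so fast that [S (a ^ 2)]
    dominates the sum of the squared coefficients of [a], uniformly in the
    degree (lemma [lognormal_sqr_ge]).  On the y-axis one uses [S] with its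
    value at [y ^ 2] lowered to [-1].  The square of [b] then costs at most a
    multiple of [b_0 ^ 2 + b_1 ^ 2], and by the two relations above this is
    compensated by a large multiple of [S (a ^ 2) + S (c ^ 2)]. *)

Set Implicit Arguments.
Unset Strict Implicit.
Unset Printing Implicit Defensive.

Import Order.TTheory GRing.Theory Num.Theory.

Local Open Scope classical_set_scope.
Local Open Scope ring_scope.

(** * A Hankel form dominating the sum of squares of coefficients *)

(** With [d = n - i], the identity [(i + n) ^ 2 + d ^ 2 = 2 i ^ 2 + 2 n ^ 2]
    says that after rescaling the [i]-th coefficient by [5 ^ (2 i ^ 2)] the
    Hankel form becomes the Toeplitz form with entries [5 ^ - (d ^ 2)], whose
    off-diagonal terms are small. *)
Lemma lognormal_offdiag (R : realFieldType) (x y : R) (i n : nat) : (i < n)%N ->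
  - (5 ^- (n - i) * ((5 ^+ (2 * i ^ 2) * x) ^+ 2 + (5 ^+ (2 * n ^ 2) * y) ^+ 2)) <=
  2 * (x * y * 5 ^+ ((i + n) ^ 2)).
Proof.
move=> lt_in; pose d := (n - i)%N.
have d_gt0 : (0 < d)%N by rewrite subn_gt0.
have -> : x * y * 5 ^+ ((i + n) ^ 2)
    = 5 ^- (d ^ 2) * ((5 ^+ (2 * i ^ 2) * x) * (5 ^+ (2 * n ^ 2) * y)).
  have e : ((i + n) ^ 2 + d ^ 2 = 2 * i ^ 2 + 2 * n ^ 2)%N.
    by rewrite -(subnKC (ltnW lt_in)) -/d; ring.
  rewrite mulrACA -exprD -e exprD (mulrC (5 ^+ _)) -(mulrA (5 ^+ _)).
  by rewrite mulKf; [exact: mulrC | rewrite expf_neq0 ?pnatr_eq0].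
have dd : 5 ^- (d ^ 2) <= 5 ^- d :> R.
  by rewrite lef_pV2 ?posrE ?exprn_gt0 ?ler_weXn2l ?ler1n // -{1}(expn1 d) leq_pexp2l.
have : 0 <= 5 ^- (d ^ 2) :> R by rewrite invr_ge0 exprn_ge0.
rewrite -/d; set u := _ * x; set v := _ * y; move: dd.
set D := 5 ^- (d ^ 2); set E := 5 ^- d => DE D0.
have uv : 0 <= (E - D) * (u ^+ 2 + v ^+ 2).
  by rewrite mulr_ge0 ?subr_ge0 // addr_ge0 ?sqr_ge0.
have := mulr_ge0 D0 (sqr_ge0 (u + v)).
clearbody D E u v; lra.
Qed.

Lemma geometric_tail (R : realFieldType) (n : nat) :
  \sum_(i < n) 5 ^- (n - i) <= 4^-1 :> R.
Proof.
elim: n => [|n IHn]; first by rewrite big_ord0 invr_ge0.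
rewrite big_ord_recr /= subSnn expr1.
have -> : \sum_(i < n) 5 ^- (n.+1 - i) = 5^-1 * \sum_(i < n) 5 ^- (n - i) :> R.
  rewrite mulr_sumr; apply: eq_bigr => i _.
  by rewrite subSn ?exprS ?invfM // ltnW.
lra.
Qed.

(** Diagonal dominance, by induction on the size of the form.  The term
    [5 / 4 * 5 ^- (n - i)] is the share of the [i]-th diagonal entry that is
    kept in reserve for the rows still to come, the geometric tail of what
    [lognormal_offdiag] will charge to it. *)
Lemma lognormal_coercive (R : realFieldType) (a : nat -> R) (n : nat) :
  \sum_(i < n) (2^-1 + 5 / 4 * 5 ^- (n - i)) * (5 ^+ (2 * i ^ 2) * a i) ^+ 2 <=
  \sum_(i < n) \sum_(j < n) a i * a j * 5 ^+ ((i + j) ^ 2).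
Proof.
elim: n => [|n IHn]; first by rewrite !big_ord0.
pose w i := (5 ^+ (2 * i ^ 2) * a i) ^+ 2.
have sym : \sum_(j < n) a n * a j * 5 ^+ ((n + j) ^ 2)
         = \sum_(i < n) a i * a n * 5 ^+ ((i + n) ^ 2).
  by apply: eq_bigr => i _; rewrite (mulrC (a n)) addnC.
rewrite [leLHS]big_ord_recr [leRHS]big_ord_recr /= subSnn.
rewrite [X in _ <= _ + X]big_ord_recr /= sym.
under [X in _ <= X + _]eq_bigr do rewrite big_ord_recr /=.
rewrite big_split /=.
have -> : a n * a n * 5 ^+ ((n + n) ^ 2) = w n.
  have -> : ((n + n) ^ 2 = 2 * n ^ 2 + 2 * n ^ 2)%N by ring.
  by rewrite /w exprD; ring.
have off : - (\sum_(i < n) 5 ^- (n - i) * w i + (\sum_(i < n) 5 ^- (n - i)) * w n)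
    <= 2 * \sum_(i < n) a i * a n * 5 ^+ ((i + n) ^ 2).
  rewrite mulr_suml -big_split /= -sumrN mulr_sumr.
  by apply: ler_sum => i _; rewrite -mulrDr lognormal_offdiag.
have -> : \sum_(i < n) (2^-1 + 5 / 4 * 5 ^- (n.+1 - i)) * w i
   = \sum_(i < n) (2^-1 + 5 / 4 * 5 ^- (n - i)) * w i - \sum_(i < n) 5 ^- (n - i) * w i.
  rewrite -sumrB; apply: eq_bigr => i _.
  have -> : (n.+1 - i = (n - i).+1)%N by rewrite subSn // ltnW.
  have -> : 5 ^- (n - i).+1 = 5^-1 * 5 ^- (n - i) :> R by rewrite exprS invfM.
  by set E := 5 ^- (n - i); field.
have tail : (\sum_(i < n) 5 ^- (n - i)) * w n <= 4^-1 * w n.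
  by rewrite ler_wpM2r ?sqr_ge0 ?geometric_tail.
rewrite expr1 -/(w n); lra.
Qed.

Section MomentFunctional.
Variables (R : comNzRingType) (s : nat -> R).

Definition moment_functional (p : {poly R}) : R := \sum_(i < size p) p`_i * s i.

(** Reindexing over any large enough range is what lets two polynomials of
    different sizes be compared term by term. *)
Lemma moment_functional_widen (N : nat) (p : {poly R}) : (size p <= N)%N ->
  moment_functional p = \sum_(i < N) p`_i * s i.
Proof.
move=> le_pN; rewrite /moment_functional (big_ord_widen _ (fun i => p`_i * s i) le_pN).
rewrite big_mkcond /=; apply: eq_bigr => i _.
by case: ltnP => // le_pi; rewrite nth_default ?mul0r.
Qed.

Lemma moment_functional_is_scalar : scalar moment_functional.
Proof.
move=> c p r; pose N := maxn (size (c *: p + r)) (maxn (size p) (size r)).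
rewrite !(@moment_functional_widen N) ?leq_max ?leqnn ?orbT //.
rewrite /= mulr_sumr -big_split /=; apply: eq_bigr => i _.
by rewrite coefD coefZ mulrDl mulrA.
Qed.

HB.instance Definition _ :=
  GRing.isLinear.Build R {poly R} R _ moment_functional moment_functional_is_scalar.

Lemma moment_functionalXn (m : nat) : moment_functional 'X^m = s m.
Proof.
rewrite /moment_functional size_polyXn big_ord_recr /= coefXn eqxx mul1r.
rewrite big1 ?add0r // => i _.
by rewrite coefXn ltn_eqF ?mul0r.
Qed.

Lemma moment_functional_sqr (p : {poly R}) :
  moment_functional (p * p) =
  \sum_(i < size p) \sum_(j < size p) p`_i * p`_j * s (i + j).
Proof.
rewrite -{1 2}[p]coefK poly_def mulr_suml linear_sum /=; apply: eq_bigr => i _.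
rewrite mulr_sumr linear_sum /=; apply: eq_bigr => j _.
by rewrite -scalerAl -scalerAr !linearZ /= -exprD moment_functionalXn mulrA.
Qed.

End MomentFunctional.

(** The factor 2 normalizes the constant [1 / 2] of [lognormal_coercive]. *)
Definition lognormal_moment (R : realFieldType) (m : nat) : R := 2 * 5 ^+ (m ^ 2).

(** The bound does not depend on the degree.  This is where a rapidly growing,
    indeterminate moment sequence is needed: for the moments of a compactly
    supported measure without atom at the origin, already the constant
    coefficient is not controlled. *)
Lemma lognormal_sqr_ge (R : realFieldType) (p : {poly R}) :
  \sum_(i < size p) p`_i ^+ 2 <= moment_functional (@lognormal_moment R) (p * p).
Proof.
rewrite moment_functional_sqr.
have -> : \sum_(i < size p) \sum_(j < size p) p`_i * p`_j * lognormal_moment R (i + j)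
  = 2 * \sum_(i < size p) \sum_(j < size p) p`_i * p`_j * 5 ^+ ((i + j) ^ 2).
  rewrite mulr_sumr; apply: eq_bigr => i _; rewrite mulr_sumr; apply: eq_bigr => j _.
  by rewrite /lognormal_moment mulrCA.
apply: le_trans (ler_wpM2l _ (lognormal_coercive (fun i => p`_i) (size p))) => //.
rewrite mulr_sumr; apply: ler_sum => i _.
have e_ge0 : 0 <= 5 ^- (size p - i) :> R by rewrite invr_ge0 exprn_ge0.
have w_ge1 : 1 <= (5 ^+ (2 * i ^ 2)) ^+ 2 :> R by rewrite -exprM exprn_ege1 ?ler1n.
have c_ge1 : 1 <= 2 * (2^-1 + 5 / 4 * 5 ^- (size p - i)) :> R by lra.
set w := (_ ^+ _) ^+ 2 in w_ge1; set c := 2^-1 + _ in c_ge1 *.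
rewrite [X in c * X]exprMn -/w mulrA mulrA.
by rewrite ler_peMl ?sqr_ge0 // mulr_ege1.
Qed.

Lemma lognormal_sqr_ge_coef2 (R : realFieldType) (p : {poly R}) (i j : nat) : i != j ->
  p`_i ^+ 2 + p`_j ^+ 2 <= moment_functional (@lognormal_moment R) (p * p).
Proof.
move=> ij; apply: le_trans (lognormal_sqr_ge p).
(* The sum of the squared coefficients of [p] is itself the moment functional
   of weights [p`_k] at [p], so it can be taken over a range containing [i]
   and [j] even if they exceed the degree. *)
rewrite -[leRHS]/(moment_functional (fun k => p`_k) p).
pose N := maxn (size p) (maxn i.+1 j.+1).
have iN : (i < N)%N by rewrite !leq_max leqnn orbT.
have jN : (j < N)%N by rewrite !leq_max leqnn !orbT.
rewrite (@moment_functional_widen _ _ N) ?leq_maxl //.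
rewrite (bigD1 (Ordinal iN)) //= (bigD1 (Ordinal jN)) /= 1?eq_sym //.
rewrite addrA lerDl; apply: sumr_ge0 => k _; exact: sqr_ge0.
Qed.

(** * Restriction to the three branches *)

Section Pullback.
Variable R : comNzRingType.

(** The polynomial [f (u, v)], that is, the pullback of [f] along the
    parametrized curve [t |-> (u t, v t)]. *)
Definition pullback (u v : {poly R}) : {mpoly R[2]} -> {poly R} :=
  mmap polyC (fun i => if i == ord0 then u else v).

HB.instance Definition _ u v := GRing.RMorphism.on (pullback u v).

Lemma pullbackZ u v c f : pullback u v (c *: f) = c *: pullback u v f.
Proof. by rewrite /pullback mmapZ mul_polyC. Qed.

Lemma pullbackX u v (m : 'X_{1..2}) :
  pullback u v 'X_[m] = u ^+ m ord0 * v ^+ m ord_max.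
Proof.
rewrite /pullback mmapX /mmap1 big_ord_recl big_ord1 /=.
by rewrite (_ : lift ord0 ord0 = ord_max) //; apply: val_inj.
Qed.

End Pullback.

(** * The witness functional *)

Section WitnessFunctional.
Variables (R : realType) (l : nat).

Notation S := (moment_functional (@lognormal_moment R)).
Notation on_xaxis := (@pullback R 'X 0).
Notation on_yaxis := (@pullback R 0 'X).
Notation on_graph := (@pullback R 'X ('X^l)).

(** Subtracting this from the moment of [y ^ 2] leaves [-1]. *)
Definition y2_shift : R := lognormal_moment R 2 + 1.

(** Chosen for the estimate in [witness_sqr_ge0]: with [k] the shift, [k ^ 2]
    pays for the loss [k ^ 2 * b_0 ^ 2], and [2 * k] for the loss
    [k * b_1 ^ 2 <= 2 * k * (a_l ^ 2 + c_l ^ 2)]. *)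
Definition branch_weight : R := y2_shift ^+ 2 + 2 * y2_shift.

Definition witness (f : {mpoly R[2]}) : R :=
  branch_weight * (S (on_xaxis f) + S (on_graph f))
  + (S (on_yaxis f) - y2_shift * (on_yaxis f)`_2).

Lemma witness_is_scalar : scalar witness.
Proof.
move=> c f g; rewrite /witness !raddfD /= !pullbackZ !scalarZ /= coefD coefZ; ring.
Qed.

HB.instance Definition _ :=
  GRing.isLinear.Build R {mpoly R[2]} R _ witness witness_is_scalar.

Lemma pullbacks_at_origin (f : {mpoly R[2]}) : (on_yaxis f)`_0 = (on_xaxis f)`_0.
Proof.
rewrite [f]mpolyE !raddf_sum !coef_sum /=; apply: eq_bigr => m _.
rewrite !pullbackZ !coefZ !pullbackX !expr0n.
case: (m ord0) => [|i]; case: (m ord_max) => [|j];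
  by rewrite /= ?expr0 ?mulr1 ?mul1r ?mul0r ?mulr0 ?coefXn ?coef0.
Qed.

(** Only the monomials [x ^ l] and [y] contribute to degree [l] on the graph,
    and the first of them contributes equally on the x-axis. *)
Lemma pullbacks_tangency (f : {mpoly R[2]}) : (0 < l)%N ->
  (on_yaxis f)`_1 = (on_graph f)`_l - (on_xaxis f)`_l.
Proof.
move=> l_gt0.
rewrite [f]mpolyE !raddf_sum !coef_sum /= -sumrB; apply: eq_bigr => m _.
rewrite !pullbackZ !coefZ !pullbackX -mulrBr; congr (_ * _).
rewrite -exprM -exprD !expr0n coefXn.
case: (m ord0) => [|i]; case: (m ord_max) => [|[|j]];
  rewrite /= ?expr0 ?mulr1 ?mul1r ?mul0r ?mulr0 ?coefXn ?coef0 ?coef1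
          ?muln0 ?muln1 ?addn0 ?add0n ?subrr ?subr0 ?eqxx //.
- by rewrite [in RHS]ltn_eqF // -[ltnLHS]muln1 ltn_pmul2l.
- by rewrite ltn_eqF // addSn ltnS leq_addl.
- by rewrite ltn_eqF // addSn ltnS (leq_trans _ (leq_addl _ _)) // leq_pmulr.
Qed.

Lemma y2_shift_ge0 : 0 <= y2_shift.
Proof. by rewrite addr_ge0 ?mulr_ge0 ?exprn_ge0. Qed.

(** In [(b ^ 2)_2 = 2 b_0 b_2 + b_1 ^ 2], the uncontrolled factor [b_2] is
    absorbed by the term [b_2 ^ 2] that the log-normal functional provides. *)
Lemma yaxis_part_lower_bound (b : {poly R}) :
  - (y2_shift ^+ 2 * b`_0 ^+ 2 + y2_shift * b`_1 ^+ 2) <=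
  S (b * b) - y2_shift * (b * b)`_2.
Proof.
have := lognormal_sqr_ge_coef2 b (isT : 1%N != 2%N).
rewrite coefM !big_ord_recl big_ord0 /= /bump /= => H.
have := sqr_ge0 (y2_shift * b`_0 - b`_2).
have := sqr_ge0 b`_1.
lra.
Qed.

(** The two relations at the origin express [b_0] and [b_1], the
    coefficients that bound the negative part of the y-axis term, by coefficients on
    the other branches, where the functional is coercive. *)
Lemma witness_sqr_ge0 (g : {mpoly R[2]}) : (0 < l)%N -> 0 <= witness (g * g).
Proof.
move=> l_gt0; rewrite /witness !rmorphM /=.
have := yaxis_part_lower_bound (on_yaxis g).
rewrite pullbacks_at_origin (pullbacks_tangency g l_gt0).
have l_neq0 : 0%N != l by rewrite eq_sym -lt0n.
have := lognormal_sqr_ge_coef2 (on_xaxis g) l_neq0.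
have := lognormal_sqr_ge_coef2 (on_graph g) l_neq0.
have := y2_shift_ge0.
rewrite /branch_weight.
move: (on_xaxis g) (on_graph g) (on_yaxis g) => a c b.
set k := y2_shift; set A := S (a * a); set C := S (c * c).
set T := S _ - _ => k0 hC hA hT.
have h1 : 0 <= (k ^+ 2 + 2 * k) * (A + C - a`_0 ^+ 2 - a`_l ^+ 2 - c`_l ^+ 2).
  apply: mulr_ge0; first by rewrite addr_ge0 ?sqr_ge0 ?mulr_ge0.
  by have := sqr_ge0 c`_0; lra.
(* This gives [b_1 ^ 2 = (c_l - a_l) ^ 2 <= 2 * (a_l ^ 2 + c_l ^ 2)], weighted
   by [k]. *)
have h2 := mulr_ge0 k0 (sqr_ge0 (a`_l + c`_l)).
have h3 := mulr_ge0 (sqr_ge0 k) (addr_ge0 (sqr_ge0 a`_l) (sqr_ge0 c`_l)).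
have h4 := mulr_ge0 k0 (sqr_ge0 a`_0).
lra.
Qed.

(** On each branch one of the three factors of the curve polynomial is zero. *)
Lemma witness_curve_poly (f : {mpoly R[2]}) : witness (curve_poly R l * f) = 0.
Proof.
have pX u v : pullback u v (varx R) = u :> {poly R}.
  by rewrite pullbackX !mnm1E expr1 expr0 mulr1.
have pY u v : pullback u v (vary R) = v :> {poly R}.
  by rewrite pullbackX !mnm1E expr1 expr0 mul1r.
rewrite /witness /curve_poly !rmorphM !rmorphB /= !rmorphXn /= !pX !pY.
rewrite !subrr !(mulr0, mul0r) coef0 !raddf0 !mulr0 !addr0.
by rewrite mulr0 subrr addr0.
Qed.

(** The two monomials are [y ^ 2] and [x ^ l y].  They agree on the x-axis and on
    the graph, so only the lowered value at [y ^ 2] is left. *)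
Lemma witness_y2_sub_xly (m m' : 'X_{1..2}) : (0 < l)%N ->
  m ord0 = 0%N -> m ord_max = 2%N -> m' ord0 = l -> m' ord_max = 1%N ->
  witness 'X_[m] - witness 'X_[m'] = -1.
Proof.
move=> l_gt0 m0 m1 n0 n1; rewrite /witness !pullbackX m0 m1 n0 n1.
rewrite !expr0 !expr1 !mul1r !expr0n (gtn_eqF l_gt0) /= !mulr0 !mul0r.
rewrite raddf0 coef0 coefXn /= mulr1n -[_ * 'X^l]expr2.
rewrite (moment_functionalXn _ 2) /y2_shift; ring.
Qed.

End WitnessFunctional.

(** * Moment and localizing matrices of a functional *)

Section SequenceOfFunctional.
Variables (R : realType) (L : {linear {mpoly R[2]} -> R}).

Definition functional_tseq (d : nat) : tseq R d := fun m => L 'X_[m].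
Arguments functional_tseq d m : clear implicits.

Lemma riesz_functional_tseq (d : nat) (f : {mpoly R[2]}) : (msize f <= d.+1)%N ->
  riesz (functional_tseq d) f = L f.
Proof.
move=> le_fd; rewrite {2}(mpolywE le_fd) linear_sum /=.
by apply: eq_bigr => m _; rewrite linearZ.
Qed.

Lemma moment_mxE (n : nat) (i j : 'I_#|{: monoms n}|) :
  moment_mx (functional_tseq n.*2) i j = L (basis_monom R i * basis_monom R j).
Proof.
rewrite mxE riesz_functional_tseq // -mpolyXD msizeX mdegD ltnS -addnn.
by rewrite leq_add // -ltnS bmdeg.
Qed.

Lemma psd_moment_mx (n : nat) : (forall g, 0 <= L (g * g)) ->
  psd (moment_mx (functional_tseq n.*2)).
Proof.
move=> L_sqr; split; first by apply/matrixP => i j; rewrite !mxE mulrC.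
move=> v; pose g := \sum_i v i 0 *: basis_monom R i.
rewrite (_ : (_ *m _) _ _ = L (g * g)) // /g mulr_suml linear_sum /= mxE.
under [RHS]eq_bigr do rewrite mulr_sumr linear_sum /=.
rewrite [RHS]exchange_big /=; apply: eq_bigr => j _.
rewrite mxE mulr_suml; apply: eq_bigr => i _.
by rewrite moment_mxE mxE -scalerAl -scalerAr !linearZ /= -mulrA (mulrC (L _)).
Qed.

Lemma principal_submx_moment_mx (n k : nat) :
  principal_submx (moment_mx (functional_tseq (n + k).*2)) =
  moment_mx (functional_tseq n.*2).
Proof.
apply/matrixP => i j; rewrite mxE !moment_mxE.
by rewrite /basis_monom !enum_rankK.
Qed.

(** The degree bound ensures that no coefficient of [p * u * v] is lost in the
    truncation, as the size of the localizing matrix is adapted to [p]. *)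
Lemma localizing_mx_eq0 (n : nat) (p : {mpoly R[2]}) : (mpdeg p <= n.*2)%N ->
  (forall h, L (p * h) = 0) -> localizing_mx (functional_tseq n.*2) p = 0.
Proof.
move=> le_pn Lp; apply/matrixP => i j; rewrite !mxE.
have [p0|p_neq0] := eqVneq p 0.
  (* [p] occurs in the type of the indices, so only the factor is rewritten. *)
  rewrite -mulrA [X in X * _]p0 mul0r /riesz big1 // => m _.
  by rewrite mcoeff0 mul0r.
rewrite riesz_functional_tseq -mulrA ?Lp // -mpolyXD.
rewrite msizeM //; last by rewrite -msize_poly_eq0 msizeX.
rewrite msizeX mdegD.
have := bmdeg (enum_val i : monoms _); have := bmdeg (enum_val j : monoms _).
move: (mdeg (enum_val i)) (mdeg (enum_val j)) le_pn => di dj.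
rewrite /mpdeg -/(uphalf _) uphalf_half.
have := odd_double_half (msize p).-1.
case: (odd _) => /=; move: (mmeasure _ _) => s; move: (_./2) => h; lia.
Qed.

Lemma psd0 (N : nat) : psd (0 : 'M[R]_N).
Proof. by split=> [|v]; rewrite ?trmx0 // mulmx0 mul0mx mxE. Qed.

(** A functional that vanishes on the ideal of [p] and is nonnegative on squares
    provides the extensions of all orders at once. *)
Lemma extension_property_functional (n k : nat) (p : {mpoly R[2]}) :
  (mpdeg p <= n.*2)%N -> (forall g, 0 <= L (g * g)) -> (forall h, L (p * h) = 0) ->
  extension_property (functional_tseq n.*2) p k.
Proof.
move=> le_pn L_sqr Lp; have le_pnk : (mpdeg p <= (n + k).*2)%N.
  by rewrite (leq_trans le_pn) // leq_double leq_addr.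
exists (functional_tseq (n + k).*2); split.
- by split; [exact: psd_moment_mx | exact: principal_submx_moment_mx].
- by rewrite localizing_mx_eq0 //; exact: psd0.
- rewrite localizing_mx_eq0; first exact: psd0.
    by rewrite /mpdeg msizeN.
  by move=> h; rewrite mulNr linearN Lp oppr0.
Qed.

End SequenceOfFunctional.
Arguments functional_tseq {R} L d m.

Lemma mpdeg_curve_poly (R : realType) (l : nat) : (0 < l)%N ->
  (mpdeg (curve_poly R l) <= l + 2)%N.
Proof.
move=> l_gt0; rewrite /mpdeg /curve_poly.
have -> : varx R * vary R * (vary R - varx R ^+ l)
   = 'X_[U_(ord0) + U_(ord_max) + U_(ord_max)]
     - 'X_[U_(ord0) + U_(ord_max) + U_(ord0) *+ l].
  by rewrite mulrBr !mpolyXD -mpolyXn.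
rewrite -subn1 leq_subLR; apply: leq_trans (msizeD_le _ _) _.
rewrite msizeN !msizeX !mdegD mdegMn !mdeg1 geq_max; apply/andP; split; lia.
Qed.

(** * The obstruction to a representing measure *)

Section NoMeasure.
Variables (R : realType) (l : nat).
Notation plane := (measurableTypeR R * measurableTypeR R)%type.

Lemma zero_set_curve_poly (z : R * R) :
  zero_set (curve_poly R l) z = (z.1 * z.2 * (z.2 - z.1 ^+ l) = 0).
Proof.
rewrite /zero_set /= /curve_poly !mevalM mevalB rmorphXn /= /varx /vary !mevalXU.
by rewrite !(tnth_nth 0).
Qed.

Lemma measurable_zero_set_curve_poly :
  measurable (zero_set (curve_poly R l) : set plane).
Proof.
pose F (z : plane) : R := z.1 * z.2 * (z.2 - z.1 ^+ l).
have -> : zero_set (curve_poly R l) = F @^-1` [set 0].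
  by apply/seteqP; split => z; rewrite zero_set_curve_poly.
rewrite -[_ @^-1` _]setTI.
have mF : measurable_fun setT F.
  apply: measurable_funM; first by apply: measurable_funM.
  by apply: measurable_funB => //; apply: measurable_funX.
apply: mF => //; exact: measurable_set1.
Qed.

(** Integrating [y ^ 2 - x ^ l y = y (y - x ^ l)], which is nonnegative on each
    of the three branches and hence almost everywhere, gives the inequality
    between the two moments. *)
Lemma representing_measure_y2_ge_xly (d : nat) (beta : tseq R d) (m m' : monoms d)
    (mu : {measure set plane -> \bar R}) : (0 < l)%N ->
  m ord0 = 0%N -> m ord_max = 2%N -> m' ord0 = l -> m' ord_max = 1%N ->
  representing_measure beta (curve_poly R l) mu -> beta m' <= beta m.
Proof.
move=> l_gt0 m0 m1 n0 n1 [supp mom].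
have [if_ ef] := mom m; have [ig eg] := mom m'.
rewrite -subr_ge0 -lee_fin EFinB -ef -eg -integralB //.
have mZ := measurable_zero_set_curve_poly.
rewrite (@negligible_integral _ _ _ mu setT (~` zero_set (curve_poly R l))) //;
  [|exact: measurableC|exact: integrableB].
rewrite setDE setTI setCK; apply: integral_ge0 => z Zz.
rewrite m0 m1 n0 n1 -EFinB lee_fin.
move: Zz; rewrite zero_set_curve_poly => /eqP.
rewrite !mulf_eq0 subr_eq0 => /orP[/orP[]|] /eqP ->.
- by rewrite expr0 mul1r expr0n gtn_eqF //= mul0r subr0 sqr_ge0.
- by rewrite expr1 expr0n /= !mulr0 subrr.
- by rewrite expr0 mul1r expr1 expr2 subrr.
Qed.

End NoMeasure.

Theorem theorem3p10 (R : realType) (l : nat) (hl : (1 < l)%N)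
    (n : nat) (hn : (l + 2 <= n)%N) :
  exists beta : tseq R n.*2,
    (forall k : nat, extension_property beta (curve_poly R l) k) /\
    ~ (exists mu : {measure set (measurableTypeR R * measurableTypeR R) -> \bar R},
         representing_measure beta (curve_poly R l) mu).
Proof.
have l_gt0 : (0 < l)%N by apply: ltnW.
exists (functional_tseq (@witness R l) n.*2); split=> [k|[mu mu_rep]].
  apply: extension_property_functional.
  - by apply: leq_trans (mpdeg_curve_poly _ l_gt0) _; lia.
  - by move=> g; exact: witness_sqr_ge0.
  - by move=> h; exact: witness_curve_poly.
pose y2 : 'X_{1..2} := (U_(ord_max) *+ 2)%MM.
pose xly : 'X_{1..2} := (U_(ord0) *+ l + U_(ord_max))%MM.
have deg_y2 : (mdeg y2 < n.*2.+1)%N by rewrite mdegMn mdeg1; lia.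
have deg_xly : (mdeg xly < n.*2.+1)%N.
  by rewrite mdegD mdegMn !mdeg1; lia.
have [m0 m1] : y2 ord0 = 0%N /\ y2 ord_max = 2%N by rewrite !mulmnE !mnm1E.
have [n0 n1] : xly ord0 = l /\ xly ord_max = 1%N.
  by rewrite !mnmDE !mulmnE !mnm1E mul1n addn0.
have := @representing_measure_y2_ge_xly R l _ _ (BMultinom deg_y2) (BMultinom deg_xly) mu
          l_gt0 m0 m1 n0 n1 mu_rep.
by rewrite -subr_ge0 (witness_y2_sub_xly R l_gt0 m0 m1 n0 n1) oppr_ge0 ler10.
Qed.
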